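(* Let $n\ge 6$ be an integer. Then $$sat(n,K_{3,3})\le \begin{cases} 2n, & 6\le n\le 8,\\ 3n-9, & n\ge 9.\end{cases}$$
   Context: All graphs are finite and simple. $K_{3,3}$ is the complete bipartite graph with both parts of size $3$, and $\overline{G}$ is the complement of $G$. A graph $G$ is $F$-saturated if $G$ does not contain $F$ as a (not necessarily induced) subgraph, but for every edge $e\in E(\overline{G})$ the graph $G+e$ contains $F$ as a subgraph. The saturation number $sat(n,F)$ is the minimum number of edges in an $n$-vertex $F$-saturated graph. *)

(* Defs.v *)
From HB Require Import structures.
From mathcomp Require Import all_boot.

Set Implicit Arguments.
Unset Strict Implicit.
Unset Printing Implicit Defensive.

Record sgraph (V : finType) := SGraph {
  edges : {set {set V}};
  edges_card2 : [forall e in edges, #|e| == 2]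
}.

HB.instance Definition _ (V : finType) := [isSub for @edges V].
HB.instance Definition _ (V : finType) := [Finite of sgraph V by <:].

Lemma edges_of_proof (V : finType) (S : {set {set V}}) :
  [forall e in [set e in S | #|e| == 2], #|e| == 2].
Proof. by apply/forall_inP => e; rewrite inE => /andP[]. Qed.

(* The graph spanned by S; members of S that are not pairs are discarded. *)
Definition graph_of (V : finType) (S : {set {set V}}) : sgraph V :=
  SGraph (edges_of_proof S).

Definition compl (V : finType) (G : sgraph V) : sgraph V :=
  graph_of (~: edges G).

Definition add_edge (V : finType) (G : sgraph V) (e : {set V}) : sgraph V :=
  graph_of (e |: edges G).

Definition complete_bipartite (s t : nat) : sgraph ('I_s + 'I_t)%type :=
  graph_of [set [set inl i; inr j] | i : 'I_s, j : 'I_t].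

Notation "''K_' ( s , t )" := (complete_bipartite s t)
  (at level 8, format "''K_' ( s ,  t )").

(* Not necessarily induced copies: non-edges of F are unconstrained. *)
Definition contains (U V : finType) (F : sgraph U) (G : sgraph V) : bool :=
  [exists f : {ffun U -> V},
     injectiveb f && [forall e in edges F, f @: e \in edges G]].

Definition saturated (U V : finType) (F : sgraph U) (G : sgraph V) : bool :=
  ~~ contains F G && [forall e in edges (compl G), contains F (add_edge G e)].

(* The initial value 'C(n, 2) bounds the size of every n-vertex graph, so it
   only matters when there is no n-vertex F-saturated graph at all; by satP
   below this does not happen if F has an edge. *)
Definition sat (U : finType) (n : nat) (F : sgraph U) : nat :=
  \big[minn/'C(n, 2)]_(G : sgraph 'I_n | saturated F G) #|edges G|.

Lemma edges_bound (n : nat) (G : sgraph 'I_n) : #|edges G| <= 'C(n, 2).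
Proof.
rewrite -[n in 'C(n, _)](card_ord n) -card_draws; apply/subset_leq_card.
apply/subsetP => e eG; rewrite inE.
exact: (forall_inP (edges_card2 G)).
Qed.

Lemma saturated_exists (U : finType) (n : nat) (F : sgraph U) :
  edges F != set0 -> exists G : sgraph 'I_n, saturated F G.
Proof.
case/set0Pn => e0 e0F.
pose G0 : sgraph 'I_n := graph_of set0.
have G0P : ~~ contains F G0.
  apply/existsP => -[f /andP[_ /forall_inP/(_ _ e0F)]].
  by rewrite !inE.
case: (@arg_maxnP _ G0 (fun G => ~~ contains F G) (fun G => #|edges G|) G0P).
move=> G GF Gmax; exists G; rewrite /saturated GF /=.
apply/forall_inP => e; rewrite !inE => /andP[eG e2].
apply: contraT => /Gmax /=.
have -> : [set d in e |: edges G | #|d| == 2] = e |: edges G; last first.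
  by rewrite cardsU1 eG add1n ltnn.
apply/setP => d; rewrite !inE andbC.
case: (d =P e) => [->|_] /=; first by rewrite e2.
case dG: (d \in edges G); last by rewrite andbF.
by rewrite (forall_inP (edges_card2 G) _ dG).
Qed.

Lemma sat_le (U : finType) (n : nat) (F : sgraph U) (G : sgraph 'I_n) :
  saturated F G -> sat n F <= #|edges G|.
Proof.
move=> GF; rewrite /sat.
have: G \in index_enum (sgraph 'I_n) by rewrite mem_index_enum.
elim: (index_enum _) => // H r IHr; rewrite inE big_cons => /predU1P[<-|/IHr le].
  by rewrite GF geq_minl.
by case: ifP => // _; rewrite geq_min le orbT.
Qed.

Lemma satP (U : finType) (n : nat) (F : sgraph U) : edges F != set0 ->
  (exists2 G : sgraph 'I_n, saturated F G & #|edges G| = sat n F) /\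
  (forall G : sgraph 'I_n, saturated F G -> sat n F <= #|edges G|).
Proof.
move=> F0; split; last exact: sat_le.
have [G0 G0F] := saturated_exists n F0.
case: (arg_minnP (fun G => #|edges G|) G0F) => G GF Gmin.
exists G => //; apply/eqP; rewrite eqn_leq sat_le // andbT.
rewrite /sat; elim/big_ind: _ => [|a b la lb|H HF]; first exact: edges_bound.
- by rewrite leq_min la.
- exact: Gmin.
Qed.

(* Main.v *)
(* Joining a new triangle completely to two fixed vertices 0 and 1 costs nine
   edges per three vertices, which is the slope of the bound, so explicit graphs
   on 9, 10 and 11 vertices generate all n >= 9.  A copy of K_{3,3} through a
   vertex of the new triangle would have to lie inside the five vertices formed
   by the triangle, 0 and 1.  Saturation survives provided every vertex other
   than 0 and 1 is adjacent to both of them, or shares two common neighbours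
   with them; the triangle's vertices are of the first kind, so this condition
   is itself preserved. *)
Require Import Defs.
From mathcomp Require Import all_boot zify.

Set Implicit Arguments.
Unset Strict Implicit.
Unset Printing Implicit Defensive.

(** * Edge lists on the natural numbers and their adjacency *)

(** Lists of numbers make adjacency computable and let a graph gain vertices without a change of
    vertex type. *)
Definition adj (L : seq (nat * nat)) : rel nat :=
  fun i j => ((i, j) \in L) || ((j, i) \in L).

Definition bounded (n : nat) (L : seq (nat * nat)) : bool :=
  all (fun e => e.1 < e.2 < n) L.

(** For the adjacency of a bounded list, which is irreflexive, the two sides are automatically
    disjoint. *)
Definition K33_free (a : rel nat) : Prop :=
  forall A B, uniq A -> uniq B -> size A = 3 -> size B = 3 -> ~~ allrel a A B.

(* If u and v are not adjacent, adding uv creates K_{3,3} with parts {u, p, q}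
   and {v, r, s}; the other disjointness conditions are then automatic. *)
Definition completes (a : rel nat) (u v p q r s : nat) : bool :=
  [&& p != q, r != s, a u r && a u s, a v p && a v q
    & [&& a p r, a p s, a q r & a q s]].

Definition K33_saturated (n : nat) (a : rel nat) : Prop :=
  forall u v, u < v < n -> ~~ a u v -> exists p q r s, completes a u v p q r s.

(** If [w] is a vertex of a new triangle, adding the edge [vw] then creates a copy with parts {v, 0,
    1} and {w, p, q}. *)
Definition anchor (a : rel nat) (v p q : nat) : bool :=
  [&& p != q, a 0 p, a 0 q, a 1 p & [&& a 1 q, a v p & a v q]].

Definition anchored (n : nat) (a : rel nat) : Prop :=
  forall v, 1 < v < n -> a 0 v && a 1 v \/ exists p q, anchor a v p q.

Lemma completes_sub (a b : rel nat) u v p q r s :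
  subrel a b -> completes a u v p q r s -> completes b u v p q r s.
Proof.
move=> ab /and5P[npq nrs /andP[ur us] /andP[vp vq] /and4P[pr ps qr qs]].
by rewrite /completes npq nrs !ab.
Qed.

Lemma anchor_sub (a b : rel nat) v p q :
  subrel a b -> anchor a v p q -> anchor b v p q.
Proof.
move=> ab /and5P[npq p0 q0 p1 /and3P[q1 vp vq]].
by rewrite /anchor npq !ab.
Qed.

Lemma adjC L i j : adj L i j = adj L j i.
Proof. by rewrite /adj orbC. Qed.

Lemma adj_bounded n L i j :
  bounded n L -> adj L i j -> [/\ i < n, j < n & i != j].
Proof.
move=> /allP bL; have lt i' j' : (i', j') \in L -> [/\ i' < n, j' < n & i' != j'].
  move=> /bL /= /andP[lij lj]; split=> //; first exact: ltn_trans lij lj.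
  by rewrite neq_ltn lij.
by case/orP=> /lt // [? ? nij]; split; rewrite // eq_sym.
Qed.

(** * From edge lists to graphs on ['I_n] *)

Section ToGraph.

Variables (n : nat) (L : seq (nat * nat)).
Hypothesis bL : bounded n L.

Definition to_graph : sgraph 'I_n :=
  graph_of [set [set x.1; x.2] | x in [set x : 'I_n * 'I_n | (val x.1, val x.2) \in L]].

Lemma mem_to_graph (i j : 'I_n) :
  ([set i; j] \in edges to_graph) = adj L i j.
Proof.
rewrite inE cards2; apply/andP/idP => [[/imsetP[[x y]]]|aij].
  rewrite inE /= => xyL /setP e nij.
  have := e i; have := e j; rewrite !inE !eqxx orbT /=.
  move: nij; rewrite eqSS eqb1 => nij.
  move=> /esym/orP[]/eqP ej /esym/orP[]/eqP ei; subst; move: nij xyL;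
    by rewrite ?eqxx // /adj => _ ->; rewrite ?orbT.
have [_ _ nij] := adj_bounded bL aij.
split; last by rewrite -val_eqE nij.
case/orP: aij => [ij|ji]; apply/imsetP.
  by exists (i, j); rewrite ?inE.
by exists (j, i); rewrite ?inE // setUC.
Qed.

Lemma card_to_graph : #|edges to_graph| <= size L.
Proof.
apply: (@leq_trans #|[set x : 'I_n * 'I_n | (val x.1, val x.2) \in L]|).
  apply: leq_trans (leq_imset_card (fun x => [set x.1; x.2]) _).
  by apply/subset_leq_card/subsetP => e; rewrite inE => /andP[].
pose h (x : 'I_n * 'I_n) := (val x.1, val x.2).
rewrite cardE -(size_map h); apply: uniq_leq_size => [|e /mapP[x]].
  rewrite map_inj_uniq ?enum_uniq // => -[x y] [x' y'] [].
  by move=> /val_inj -> /val_inj ->.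
by rewrite mem_enum inE => xL ->.
Qed.

Lemma to_graph_saturated :
  K33_free (adj L) -> K33_saturated n (adj L) -> saturated 'K_(3, 3) to_graph.
Proof.
move=> freeL satL; apply/andP; split.
  apply/existsP => -[f /andP[/injectiveP finj /forall_inP fE]].
  pose A := [seq val (f (inl i)) | i <- enum 'I_3].
  pose B := [seq val (f (inr i)) | i <- enum 'I_3].
  have uA : uniq A.
    by rewrite map_inj_uniq ?enum_uniq // => i j /val_inj/finj[].
  have uB : uniq B.
    by rewrite map_inj_uniq ?enum_uniq // => i j /val_inj/finj[].
  have sA : size A = 3 by rewrite size_map size_enum_ord.
  have sB : size B = 3 by rewrite size_map size_enum_ord.
  apply: (negP (freeL A B uA uB sA sB)).
  apply/allrelP => _ _ /mapP[i _ ->] /mapP[j _ ->].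
  have /fE: [set inl i; inr j] \in edges 'K_(3, 3).
    by rewrite inE cards2 andbT; apply: imset2_f.
  by rewrite imsetU1 imset_set1 mem_to_graph.
apply/forall_inP => e; rewrite inE => /andP[] + /cards2P[x [y [nxy ee]]].
rewrite {e}ee inE.
wlog lxy : x y nxy / x < y.
  move=> W; case: (ltngtP x y) => [lt|lt|/val_inj exy]; first exact: W.
    by rewrite setUC; apply: W; rewrite // eq_sym.
  by rewrite exy eqxx in nxy.
rewrite mem_to_graph => naxy.
have [|p [q [r [s]]]] := satL x y _ naxy; first by rewrite lxy ltn_ord.
move=> /and5P[npq nrs /andP[xr xs] /andP[yp yq] /and4P[pr ps qr qs]].
have B i j : adj L i j -> j < n by move=> /(adj_bounded bL)[].
have I i j : adj L i j -> i != j by move=> /(adj_bounded bL)[].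
(* This separates [x] from [p], [q], which are neighbours of [y], and [y] from [r], [s], which are
   neighbours of [x]. *)
have D i j k : ~~ adj L i j -> adj L i k -> j != k.
  by move=> nij ik; apply: contraNneq nij => ->.
have [py qy] : adj L p y /\ adj L q y by rewrite !(adjC L _ y).
have nayx : ~~ adj L y x by rewrite adjC.
(* The first three entries form one part and the last three the other, matching [unsplit]; the first
   entries of the two parts are joined by the added edge. *)
pose t : 6.-tuple 'I_n := [tuple x; Ordinal (B _ _ yp); Ordinal (B _ _ yq); y;
  Ordinal (B _ _ xr); Ordinal (B _ _ xs)].
have tinj : injective (tnth t).
  apply/tuple_uniqP; rewrite /= !inE !negb_or -!val_eqE /=.
  rewrite npq nrs.
  rewrite (I _ _ xr) (I _ _ xs) (I _ _ pr) (I _ _ ps) (I _ _ qr) (I _ _ qs).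
  rewrite (D _ _ _ nayx yp) (D _ _ _ nayx yq) (D _ _ _ naxy xr) (D _ _ _ naxy xs).
  by rewrite (I _ _ py) (I _ _ qy) nxy.
apply/existsP; exists [ffun z => tnth t (@unsplit 3 3 z)]; apply/andP; split.
  apply/injectiveP => z z'; rewrite !ffunE => /tinj.
  exact: (can_inj (@unsplitK 3 3)).
apply/forall_inP => e; rewrite inE => /andP[/imset2P[i j _ _ ->] _].
rewrite imsetU1 imset_set1 !ffunE.
have sub (u v : 'I_n) : adj L u v -> [set u; v] \in edges (add_edge to_graph [set x; y]).
  rewrite -mem_to_graph => uv; rewrite inE setU1r //=.
  exact: forall_inP (edges_card2 to_graph) _ uv.
have xy : [set x; y] \in edges (add_edge to_graph [set x; y]).
  by rewrite inE setU11 cards2 nxy.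
rewrite !(tnth_nth x).
by case: i j => [[|[|[|//]]] ?] [[|[|[|//]]] ?] /=; auto.
Qed.

End ToGraph.

Lemma sat_K33_leq n L :
  bounded n L -> K33_free (adj L) -> K33_saturated n (adj L) ->
  sat n 'K_(3, 3) <= size L.
Proof.
move=> bL freeL satL; apply: leq_trans (card_to_graph n L).
exact/sat_le/to_graph_saturated.
Qed.

(** * Joining a new triangle to the vertices 0 and 1 *)

Definition add_triangle (n : nat) (L : seq (nat * nat)) : seq (nat * nat) :=
  [:: (0, n); (0, n.+1); (0, n.+2); (1, n); (1, n.+1); (1, n.+2);
      (n, n.+1); (n, n.+2); (n.+1, n.+2)] ++ L.

Section AddTriangle.

Variables (n : nat) (L : seq (nat * nat)).
Hypotheses (n_gt1 : 1 < n) (bL : bounded n L).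
Let a := adj L.
Let a' := adj (add_triangle n L).

Lemma add_triangle_bounded : bounded n.+3 (add_triangle n L).
Proof.
rewrite /bounded all_cat; apply/andP; split.
  by rewrite /=; lia.
by apply: sub_all bL => e /=; lia.
Qed.

Lemma add_triangle_sub i j : a i j -> a' i j.
Proof. by rewrite /a /a' /adj !mem_cat => /orP[] ->; rewrite !orbT. Qed.

Lemma add_triangle_old i j : i < n -> j < n -> a' i j = a i j.
Proof.
move=> lt_i lt_j; rewrite /a /a' /adj !mem_cat !inE !xpair_eqE.
have N k l : k < n -> (k == n + l) = false.
  by move=> lt; rewrite ltn_eqF // ltn_addr.
move: (N i 0 lt_i) (N j 0 lt_j) (N i 1 lt_i) (N j 1 lt_j) (N i 2 lt_i) (N j 2 lt_j).
by rewrite !addn0 !addn1 !addn2 => -> -> -> -> -> ->; rewrite !andbF.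
Qed.

Lemma add_triangle_new t i : n <= t < n.+3 ->
  a' t i = (i != t) && (i \in [:: 0; 1; n; n.+1; n.+2]).
Proof.
move=> /andP[le_nt lt_t].
have notL k l : n <= maxn k l -> (k, l) \notin L.
  by apply: contraL => /(allP bL)/=; lia.
rewrite /a' /adj !mem_cat !(negPf (notL _ _ _)) ?orbF; try lia.
rewrite !inE !xpair_eqE.
have n0 : (n == 0) = false by lia.
have n1 : (n == 1) = false by lia.
have nn1 k : (k == k.+1) = false by lia.
have nn2 k : (k == k.+2) = false by lia.
have: t \in [:: n; n.+1; n.+2] by rewrite !inE; lia.
rewrite !inE => /or3P[] /eqP ->;
  rewrite ?eqSS ?(eq_sym _.+1 n) ?(eq_sym _.+2 n) ?n0 ?n1 ?nn1 ?nn2 ?eqxx;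
  rewrite ?andbT ?andbF /=; lia.
Qed.

Lemma add_triangle_free : K33_free a -> K33_free a'.
Proof.
move=> free A B uA uB sA sB; apply/negP => AB.
(* A triangle vertex in [X] forces [Y] into [S]. Having three elements, [Y] cannot fit in {0, 1}, so
   it also meets the triangle and forces [X] into [S]. Six distinct vertices do not fit in the five
   of [S]. *)
have in5 X Y t : uniq X -> uniq Y -> size X = 3 -> size Y = 3 -> allrel a' X Y ->
    n <= t -> t \notin X.
  move=> uX uY sX sY /allrelP XY le_nt; apply/negP => tX.
  pose S := [:: 0; 1; n; n.+1; n.+2].
  have nbrS x y : n <= x -> a' x y -> y \in S.
    move=> le_nx xy; have [lt_x _ _] := adj_bounded add_triangle_bounded xy.
    by move: xy; rewrite add_triangle_new ?le_nx // => /andP[].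
  have YS : {subset Y <= S} by move=> y /(XY _ _ tX)/(nbrS _ _ le_nt).
  have [y yY le_ny] : exists2 y, y \in Y & n <= y.
    apply/hasP; apply: contraTT isT => /hasPn noY.
    have: size Y <= size [:: 0; 1]; last by rewrite sY.
    apply: uniq_leq_size => // y yY.
    by have := noY y yY; have := YS y yY; rewrite !inE; lia.
  have XS : {subset X <= S}.
    by move=> x /XY/(_ yY); rewrite /a' adjC; apply: nbrS.
  have uXY : uniq (X ++ Y).
    rewrite cat_uniq uX uY andbT; apply/hasPn => y' yY'; apply/negP => yX'.
    by have [_ _] := adj_bounded add_triangle_bounded (XY _ _ yX' yY'); rewrite eqxx.
  have: size (X ++ Y) <= size S.
    by apply: uniq_leq_size => // x; rewrite mem_cat => /orP[/XS|/YS].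
  by rewrite size_cat sX sY.
have BA : allrel a' B A.
  by rewrite allrelC; apply: sub_allrel AB => i j; rewrite /a' adjC.
apply: (negP (free A B uA uB sA sB)).
apply/allrelP => x y xA yB; rewrite -add_triangle_old; first exact: (allrelP AB).
  by rewrite ltnNge; apply: contraL xA; apply: in5 AB.
by rewrite ltnNge; apply: contraL yB; apply: in5 BA.
Qed.

Lemma add_triangle_saturated :
  K33_saturated n a -> anchored n a -> K33_saturated n.+3 a'.
Proof.
move=> satL anc u v /andP[lt_uv lt_v] nuv.
have [lt_vn|le_nv] := ltnP v n.
  move: nuv; rewrite add_triangle_old ?(ltn_trans lt_uv) // => nuv.
  have [|p [q [r [s]]]] := satL u v _ nuv; first by rewrite lt_uv.
  by move/(completes_sub add_triangle_sub); exists p, q, r, s.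
have newE i j : n <= i < n.+3 ->
    (a' i j = (j != i) && (j \in [:: 0; 1; n; n.+1; n.+2])) *
    (a' j i = (j != i) && (j \in [:: 0; 1; n; n.+1; n.+2])).
  by move=> ni; rewrite {2}/a' adjC -/a' add_triangle_new.
(* Here [v] is a triangle vertex, hence adjacent to 0, 1 and the rest of the triangle. *)
have lt_un : 1 < u < n.
  by move: nuv; rewrite (newE v) ?le_nv // !inE; lia.
have [/andP[u0 u1]|[p [q /and5P[npq p0 q0 p1 /and3P[q1 up uq]]]]] := anc u lt_un.
  (* [t] and [t'] are the other two triangle vertices; the parts are {u, t, t'} and {v, 0, 1}. *)
  pose t := if v == n then n.+1 else n.
  pose t' := if v == n.+2 then n.+1 else n.+2.
  have tn : n <= t < n.+3 by rewrite /t; case: ifP; lia.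
  have tn' : n <= t' < n.+3 by rewrite /t'; case: ifP; lia.
  exists t, t', 0, 1; rewrite /completes !(newE t) // !(newE t') // !inE.
  have [-> ->] : a' u 0 /\ a' u 1 by rewrite /a' !(adjC _ u) -/a' !add_triangle_sub.
  by rewrite /t /t'; do 2!case: ifP; lia.
exists 0, 1, p, q; rewrite /completes npq !(add_triangle_sub p0, add_triangle_sub q0,
  add_triangle_sub p1, add_triangle_sub q1, add_triangle_sub up, add_triangle_sub uq).
by rewrite !(newE v) ?le_nv // !inE; lia.
Qed.

Lemma add_triangle_anchored : anchored n a -> anchored n.+3 a'.
Proof.
move=> anc v /andP[v_gt1 lt_v]; have [lt_vn|le_nv] := ltnP v n.
  have [|/andP[v0 v1]|[p [q vpq]]] := anc v _; first by rewrite v_gt1.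
    by left; rewrite !add_triangle_sub.
  by right; exists p, q; apply: anchor_sub vpq; apply: add_triangle_sub.
left; rewrite /a' ![adj _ _ v]adjC -/a' !add_triangle_new ?le_nv // !inE.
lia.
Qed.

End AddTriangle.

(** * Decision procedures for the three conditions *)

Lemma count_gt1 (T : eqType) (P : pred T) (s : seq T) :
  uniq s -> 1 < count P s ->
  exists x y, [/\ x != y, P x && (x \in s) & P y && (y \in s)].
Proof.
move=> us; rewrite -size_filter; have := filter_uniq P us.
have sP x : x \in filter P s -> P x && (x \in s) by rewrite mem_filter.
case: filter sP => [|x [|y t]] //= sP /andP[+ _] _.
by rewrite inE negb_or => /andP[nxy _]; exists x, y; rewrite !sP ?inE ?eqxx ?orbT.
Qed.

Section Decision.

Variables (n : nat) (L : seq (nat * nat)).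
Let V := iota 0 n.
Let a := adj L.

(* The filters stand in for conditionals, whose branches a strict evaluator
   would all explore. *)
Definition K33_freeb : bool :=
  all (fun p => all (fun q =>
    let W := [seq w <- V | a p w && a q w] in
    all (fun r => count (a r) W <= 2) [seq r <- V | uniq [:: p; q; r]]) V) V.

(** The letters are those of [completes]; counting the neighbours of [q] in [X] replaces a search
    over [r] and [s]. *)
Definition K33_saturatedb : bool :=
  all (fun u => all (fun v =>
    let W := [seq p <- V | a v p] in
    has (fun p =>
      let X := [seq r <- V | a u r && a p r] in
      has (fun q => 1 < count (a q) X) [seq q <- W | p != q]) W)
    [seq v <- V | (u < v) && ~~ a u v]) V.

Definition anchoredb : bool :=
  all (fun v => (1 < v) ==> (a 0 v && a 1 v)
    || has (fun p => has (anchor a v p) V) V) V.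

Hypothesis bL : bounded n L.

Lemma K33_freeP : K33_freeb -> K33_free a.
Proof.
move=> /allP free [|p [|q [|r []]]] // B uA uB _ sB; apply/negP => /allrelP AB.
have memV x y : a x y -> x \in V by move=> /(adj_bounded bL)[]; rewrite mem_iota.
have b0B : nth 0 B 0 \in B by rewrite mem_nth ?sB.
have pV := memV _ _ (AB p _ (mem_head _ _) b0B).
have qV := memV _ _ (AB q _ (mem_nth 0 (isT : 1 < size [:: p; q; r])) b0B).
have rV := memV _ _ (AB r _ (mem_nth 0 (isT : 2 < size [:: p; q; r])) b0B).
have rU : r \in [seq r <- V | uniq [:: p; q; r]] by rewrite mem_filter uA.
have := allP (allP (free p pV) q qV) r rU.
(* [2 < m] is [3 <= m], so the goal becomes that [B] is no longer than the list of common neighbours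
   of [p], [q], [r], which contains it. *)
rewrite -size_filter leqNgt -sB => /negP; apply.
apply: uniq_leq_size => // b bB; rewrite !mem_filter.
rewrite !AB ?inE ?eqxx ?orbT //=.
by apply: (memV b p); rewrite /a adjC; apply: AB; rewrite // mem_head.
Qed.

Lemma K33_saturatedP : K33_saturatedb -> K33_saturated n a.
Proof.
move=> /allP sat u v /andP[lt_uv lt_v] nuv.
have uV : u \in V by rewrite mem_iota (ltn_trans lt_uv).
have vV : v \in [seq v <- V | (u < v) && ~~ a u v].
  by rewrite mem_filter lt_uv nuv mem_iota.
have /hasP[p] := allP (sat u uV) v vV; rewrite mem_filter => /andP[vp _].
case/hasP => q; rewrite !mem_filter => /and3P[npq vq _].
case/(count_gt1 (filter_uniq _ (iota_uniq 0 n))) => r [s [nrs]].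
rewrite !mem_filter => /and3P[qr /andP[ur pr] _] /and3P[qs /andP[us ps] _].
by exists p, q, r, s; rewrite /completes npq nrs ur us vp vq pr ps qr.
Qed.

Lemma anchoredP : anchoredb -> anchored n a.
Proof.
move=> /allP anc v /andP[v_gt1 lt_v].
have vV : v \in V by rewrite mem_iota.
have /implyP/(_ v_gt1)/orP[|/hasP[p _ /hasP[q _ pq]]] := anc v vV; first by left.
by right; exists p, q.
Qed.

End Decision.

(** * Explicit saturated graphs and the final bound *)

(* The octahedron K_{2,2,2}. *)
Definition edges6 : seq (nat * nat) :=
  [:: (0, 2); (0, 3); (0, 4); (0, 5); (1, 2); (1, 3); (1, 4); (1, 5);
      (2, 4); (2, 5); (3, 4); (3, 5)].

(* The graphs on 7, 8 and 11 vertices come from a computer search. *)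
Definition edges7 : seq (nat * nat) :=
  [:: (0, 2); (0, 3); (0, 4); (0, 5); (1, 2); (1, 3); (1, 5); (2, 3);
      (2, 5); (2, 6); (3, 4); (3, 5); (4, 5); (4, 6)].

Definition edges8 : seq (nat * nat) :=
  [:: (0, 4); (0, 7); (1, 2); (1, 3); (1, 4); (1, 5); (1, 7); (2, 4);
      (2, 6); (2, 7); (3, 4); (3, 6); (3, 7); (4, 6); (5, 6); (6, 7)].

(* On 9 and 10 vertices: the join of {0, 1} with the disjoint union of the
   4-cycle 4-6-5-7 and K_1, resp. K_2, plus the vertices 2 and 3 attached to
   opposite pairs of the 4-cycle. *)
Definition edges9 : seq (nat * nat) :=
  [:: (0, 4); (0, 5); (0, 6); (0, 7); (0, 8); (1, 4); (1, 5); (1, 6);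
      (1, 7); (1, 8); (2, 4); (2, 5); (3, 6); (3, 7); (4, 6); (4, 7);
      (5, 6); (5, 7)].

Definition edges10 : seq (nat * nat) :=
  [:: (0, 4); (0, 5); (0, 6); (0, 7); (0, 8); (0, 9); (1, 4); (1, 5);
      (1, 6); (1, 7); (1, 8); (1, 9); (2, 4); (2, 5); (3, 6); (3, 7);
      (4, 6); (4, 7); (5, 6); (5, 7); (8, 9)].

Definition edges11 : seq (nat * nat) :=
  [:: (0, 2); (0, 4); (0, 7); (0, 8); (0, 9); (1, 2); (1, 4); (1, 6);
      (1, 7); (1, 8); (1, 9); (2, 3); (2, 4); (2, 7); (3, 8); (4, 5);
      (4, 6); (4, 8); (4, 10); (5, 7); (5, 10); (6, 8); (7, 8); (7, 10)].

Lemma sparse_saturated n : 9 <= n ->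
  exists L, [/\ bounded n L, K33_free (adj L), K33_saturated n (adj L),
    anchored n (adj L) & size L = 3 * n - 9].
Proof.
have base m L : [&& bounded m L, K33_freeb m L, K33_saturatedb m L & anchoredb m L] ->
    size L = 3 * m - 9 ->
    exists L, [/\ bounded m L, K33_free (adj L), K33_saturated m (adj L),
      anchored m (adj L) & size L = 3 * m - 9].
  move=> /and4P[bL free satL anc] sL; exists L; split=> //.
  - exact: K33_freeP free.
  - exact: K33_saturatedP satL.
  - exact: anchoredP anc.
elim/ltn_ind: n => n IHn n_ge9.
have [n_le11|n_gt11] := leqP n 11.
  have: n \in [:: 9; 10; 11] by rewrite !inE; lia.
  rewrite !inE => /or3P[]/eqP->.
  - by apply: (base _ edges9); vm_compute.
  - by apply: (base _ edges10); vm_compute.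
  - by apply: (base _ edges11); vm_compute.
(* The order is now [n.+3 >= 12], so the induction hypothesis applies to [n >= 9]; the nine new
   edges turn 3n - 9 into 3(n + 3) - 9. *)
case: n n_ge9 n_gt11 IHn => [|[|[|n]]] // _ n_gt11 /(_ n)[||L [bL free satL anc sL]];
  try lia.
have n_gt1 : 1 < n by lia.
exists (add_triangle n L); split.
- exact: add_triangle_bounded.
- exact: add_triangle_free.
- exact: add_triangle_saturated.
- exact: add_triangle_anchored.
- by rewrite size_cat sL /=; lia.
Qed.

Theorem theorem1p2 (n : nat) (hn : 6 <= n) :
  sat n 'K_(3, 3) <= (if n <= 8 then 2 * n else 3 * n - 9).
Proof.
have small m L : [&& bounded m L, K33_freeb m L & K33_saturatedb m L] ->
    sat m 'K_(3, 3) <= size L.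
  move=> /and3P[bL free satL]; apply: sat_K33_leq => //.
    exact: K33_freeP free.
  exact: K33_saturatedP satL.
case: (leqP n 8) => [n_le8|n_gt8].
  have: n \in [:: 6; 7; 8] by rewrite !inE; lia.
  rewrite !inE => /or3P[]/eqP->.
  (* The three lists have 12, 14 and 16 entries, so their sizes are convertible to [2 * n]. *)
  - by apply: (small _ edges6); vm_compute.
  - by apply: (small _ edges7); vm_compute.
  - by apply: (small _ edges8); vm_compute.
by have [L [bL free satL _ <-]] := sparse_saturated n_gt8; apply: sat_K33_leq.
Qed.
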